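(* Let $k$ be a commutative ring, let $A$ be a Hopf subalgebra of a Hopf algebra $E$ over $k$, let $H$ be an $A$-complement of $E$, and let $r:H\to A$ be a deformation map of the associated canonical matched pair $(A,H,\triangleright,\triangleleft)$. (1) Let $f_r:H\to A\otimes H$ be the coalgebra map defined for any $h\in H$ by $f_r(h)=r(h_{(1)})\otimes h_{(2)}$. Then $\mathbb{H}:=\mathrm{Im}(f_r)$ is an $A$-complement of $E\cong A\bowtie H$. (2) Let $H_r:=H$ as a coalgebra, with the new multiplication $\bullet$ defined for any $h,g\in H$ by $$h\bullet g:=\bigl(h\triangleleft r(g_{(1)})\bigr)\,g_{(2)}.$$ Then $H_r=(H_r,\bullet,1_H,\Delta_H,\varepsilon_H)$ is a Hopf algebra with antipode $$S:H_r\to H_r,\qquad S(h):=S_H(h_{(2)})\triangleleft (S_A\circ r)(h_{(1)})$$ for all $h\in H$ (called the $r$-deformation of $H$). Furthermore, $H_r\cong\mathbb{H}$ as Hopf algebras.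
   Context: All coalgebras, Hopf algebras and tensor products are over a commutative ring $k$; Sweedler notation $\Delta(c)=c_{(1)}\otimes c_{(2)}$ is used. $S_A,S_H$ denote the antipodes of $A,H$. A Hopf subalgebra of $E$ is a Hopf algebra inclusion $A\subseteq E$ that splits $k$-linearly. An $A$-complement of $E$ is a Hopf subalgebra $H\subseteq E$ such that the multiplication map $A\otimes H\to E$, $a\otimes h\mapsto ah$, is bijective. A matched pair of Hopf algebras $(A,H,\triangleright,\triangleleft)$ consists of Hopf algebras $A,H$ and coalgebra maps $\triangleleft:H\otimes A\to H$, $\triangleright:H\otimes A\to A$ such that $(H,\triangleleft)$ is a right $A$-module coalgebra, $(A,\triangleright)$ is a left $H$-module coalgebra, and for all $a,b\in A$, $g,h\in H$: $h\triangleright 1_A=\varepsilon_H(h)1_A$; $1_H\triangleleft a=\varepsilon_A(a)1_H$; $g\triangleright(ab)=(g_{(1)}\triangleright a_{(1)})\bigl((g_{(2)}\triangleleft a_{(2)})\triangleright b\bigr)$; $(gh)\triangleleft a=\bigl(g\triangleleft(h_{(1)}\triangleright a_{(1)})\bigr)(h_{(2)}\triangleleft a_{(2)})$; $g_{(1)}\triangleleft a_{(1)}\otimes g_{(2)}\triangleright a_{(2)}=g_{(2)}\triangleleft a_{(2)}\otimes g_{(1)}\triangleright a_{(1)}$. Its bicrossed product $A\bowtie H$ is the Hopf algebra $A\otimes H$ (with $a\bowtie h:=a\otimes h$) with multiplication $(a\bowtie h)(c\bowtie g)=a(h_{(1)}\triangleright c_{(1)})\bowtie(h_{(2)}\triangleleft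 c_{(2)})g$, unit $1_A\bowtie 1_H$ and the tensor product coalgebra structure. If $H$ is an $A$-complement of $E$, the associated canonical matched pair $(A,H,\triangleright,\triangleleft)$ is the matched pair determined by $ha=(h_{(1)}\triangleright a_{(1)})(h_{(2)}\triangleleft a_{(2)})$ in $E$, for all $a\in A$, $h\in H$; explicitly, if $m:A\otimes H\to E$ is the multiplication map, then $h\triangleright a=(\mathrm{Id}_A\otimes\varepsilon_H)(m^{-1}(ha))$ and $h\triangleleft a=(\varepsilon_A\otimes\mathrm{Id}_H)(m^{-1}(ha))$. The map $m_E:A\bowtie H\to E$, $a\bowtie h\mapsto ah$, is then an isomorphism of Hopf algebras, and $E$ is identified with $A\bowtie H$ through it; under it $A$ corresponds to $\{a\bowtie 1_H\mid a\in A\}$. A deformation map of a matched pair $(A,H,\triangleright,\triangleleft)$ is a coalgebra map $r:H\to A$ with $r(1_H)=1_A$ which is cocentral, i.e. $r(h_{(1)})\otimes h_{(2)}=r(h_{(2)})\otimes h_{(1)}$ for all $h\in H$, and satisfies, for all $g,h\in H$, $$r\bigl((h\triangleleft r(g_{(1)}))\,g_{(2)}\bigr)=r(h_{(1)})\,\bigl(h_{(2)}\triangleright r(g)\bigr).$$ *)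

(* Defs.v *)
From HB Require Import structures.
From mathcomp Require Import all_boot all_algebra.
From mathcomp Require Import boolp classical_sets.

Set Implicit Arguments.
Unset Strict Implicit.
Unset Printing Implicit Defensive.

Import GRing.Theory.
Local Open Scope ring_scope.
Local Open Scope quotient_scope.

Reserved Notation "A ⊗ B" (at level 40, left associativity).
Reserved Notation "\sw_ ( a , b <- t ) F"
  (at level 41, F at level 41, a name, b name, t at level 60,
   format "'[' \sw_ ( a ,  b  <-  t ) '/  '  F ']'").

Definition is_bilinear (k : pzRingType) (U V W : lmodType k) (f : U -> V -> W) :=
  (forall v, linear (f^~ v)) /\ (forall u, linear (f u)).

(* The tensor product of two modules: finite formal sums of pairs, represented
   as sequences, modulo the congruence generated by the tensor relations.  No
   coefficients are needed since c (a ⊗ b) = (c a) ⊗ b. *)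
Section Tensor.
Variables (k : comPzRingType) (A B : lmodType k).

Inductive tensor_cong : seq (A * B) -> seq (A * B) -> Prop :=
| tensor_refl s : tensor_cong s s
| tensor_sym s t : tensor_cong s t -> tensor_cong t s
| tensor_trans s t u : tensor_cong s t -> tensor_cong t u -> tensor_cong s u
| tensor_cat s s' t t' :
    tensor_cong s s' -> tensor_cong t t' -> tensor_cong (s ++ t) (s' ++ t')
| tensor_catC s t : tensor_cong (s ++ t) (t ++ s)
| tensor_zero b : tensor_cong [:: (0, b)] [::]
| tensor_addl a a' b : tensor_cong [:: (a + a', b)] [:: (a, b); (a', b)]
| tensor_addr a b b' : tensor_cong [:: (a, b + b')] [:: (a, b); (a, b')]
| tensor_scale c a b : tensor_cong [:: (c *: a, b)] [:: (a, c *: b)].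

Definition tensor_rel (s t : seq (A * B)) : bool := `[< tensor_cong s t >].

Fact tensor_rel_refl : reflexive tensor_rel.
Proof. by move=> s; apply/asboolP; apply: tensor_refl. Qed.
Fact tensor_rel_sym : symmetric tensor_rel.
Proof. by move=> s t; apply/asboolP/asboolP; apply: tensor_sym. Qed.
Fact tensor_rel_trans : transitive tensor_rel.
Proof.
by move=> t s u /asboolP st /asboolP tu; apply/asboolP/(tensor_trans st tu).
Qed.

Canonical tensor_equiv :=
  EquivRel tensor_rel tensor_rel_refl tensor_rel_sym tensor_rel_trans.

Definition tensor : Type := {eq_quot tensor_rel}.
HB.instance Definition _ := Choice.on tensor.
HB.instance Definition _ := EqQuotient.on tensor.

Definition tclass (s : seq (A * B)) : tensor := \pi_tensor s.

Lemma tclassK (x : tensor) : tclass (repr x) = x.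
Proof. exact: reprK. Qed.
Lemma tensorW (P : tensor -> Prop) :
  (forall s, P (tclass s)) -> forall x, P x.
Proof. by move=> PW x; rewrite -[x]tclassK. Qed.

Lemma tensor_piP (s t : seq (A * B)) :
  tclass s = tclass t <-> tensor_cong s t.
Proof.
split=> [/eqmodP /asboolP //|st]; apply/eqmodP/asboolP; exact: st.
Qed.

Lemma tensor_repr (s : seq (A * B)) : tensor_cong (repr (tclass s)) s.
Proof. by apply/tensor_piP; rewrite tclassK. Qed.

Definition tscale_seq (c : k) (s : seq (A * B)) :=
  [seq (c *: p.1, p.2) | p <- s].

Lemma tscale_cong c s t :
  tensor_cong s t -> tensor_cong (tscale_seq c s) (tscale_seq c t).
Proof.
elim=> {s t}; rewrite /tscale_seq /=.
- by move=> s; apply: tensor_refl.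
- by move=> s t _; apply: tensor_sym.
- by move=> s t u _ + _; apply: tensor_trans.
- by move=> s s' t t' _ + _; rewrite !map_cat; apply: tensor_cat.
- by move=> s t; rewrite !map_cat; apply: tensor_catC.
- by move=> b; rewrite scaler0; apply: tensor_zero.
- by move=> a a' b; rewrite scalerDr; apply: tensor_addl.
- by move=> a b b'; apply: tensor_addr.
- by move=> c' a b; rewrite !scalerA mulrC -scalerA; apply: tensor_scale.
Qed.

Definition tadd (x y : tensor) : tensor := tclass (repr x ++ repr y).
Definition tscale (c : k) (x : tensor) : tensor := tclass (tscale_seq c (repr x)).
Definition tzero : tensor := tclass [::].
Definition topp (x : tensor) : tensor := tscale (-1) x.

Lemma tadd_pi s t : tadd (tclass s) (tclass t) = tclass (s ++ t).
Proof. by apply/tensor_piP/tensor_cat; apply: tensor_repr. Qed.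
Lemma tscale_pi c s : tscale c (tclass s) = tclass (tscale_seq c s).
Proof. exact/tensor_piP/tscale_cong/tensor_repr. Qed.

Lemma taddA : associative tadd.
Proof.
elim/tensorW=> s; elim/tensorW=> t; elim/tensorW=> u.
by rewrite !tadd_pi catA.
Qed.
Lemma taddC : commutative tadd.
Proof.
elim/tensorW=> s; elim/tensorW=> t; rewrite !tadd_pi.
exact/tensor_piP/tensor_catC.
Qed.
Lemma tadd0 : left_id tzero tadd.
Proof. by elim/tensorW=> s; rewrite tadd_pi. Qed.

Lemma tensor_addl_seq c d s :
  tensor_cong (tscale_seq (c + d) s) (tscale_seq c s ++ tscale_seq d s).
Proof.
elim: s => [|[a b] s IHs]; first exact: tensor_refl.
rewrite /tscale_seq /= -!/(tscale_seq _ _) -cat1s.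
rewrite -[X in tensor_cong _ X]/([:: (c *: a, b)] ++ tscale_seq c s ++
   ([:: (d *: a, b)] ++ tscale_seq d s)).
have -> : ((c + d) *: a, b) = (c *: a + d *: a, b) by rewrite scalerDl.
apply: tensor_trans (tensor_cat (tensor_addl _ _ _) IHs) _.
rewrite -[X in tensor_cong X _]/([:: (c *: a, b)] ++ ([:: (d *: a, b)] ++
  (tscale_seq c s ++ tscale_seq d s))).
apply: tensor_cat; first exact: tensor_refl.
rewrite !catA; apply: tensor_cat; last exact: tensor_refl.
exact: tensor_catC.
Qed.

Lemma tscale0_seq s : tensor_cong (tscale_seq 0 s) [::].
Proof.
elim: s => [|[a b] s IHs]; first exact: tensor_refl.
rewrite /tscale_seq /= -/(tscale_seq _ _) -cat1s scale0r.
exact: tensor_cat (tensor_zero b) IHs.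
Qed.

Lemma tscale1 : left_id 1 tscale.
Proof.
elim/tensorW=> s; rewrite tscale_pi; congr (tclass _).
by rewrite /tscale_seq -[RHS]map_id; apply: eq_map => -[a b] /=; rewrite scale1r.
Qed.

Lemma tscaleDl x : {morph tscale^~ x : c d / c + d >-> tadd c d}.
Proof.
elim/tensorW: x => s c d; rewrite !tscale_pi tadd_pi.
exact/tensor_piP/tensor_addl_seq.
Qed.

Lemma taddN : left_inverse tzero topp tadd.
Proof.
elim/tensorW=> s.
rewrite -{2}[tclass s]tscale1 /topp -tscaleDl addNr tscale_pi.
exact/tensor_piP/tscale0_seq.
Qed.

HB.instance Definition _ :=
  GRing.isZmodule.Build tensor taddA taddC tadd0 taddN.

Lemma tscaleA c d x : tscale c (tscale d x) = tscale (c * d) x.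
Proof.
elim/tensorW: x => s; rewrite !tscale_pi; congr (tclass _).
by rewrite /tscale_seq -map_comp; apply: eq_map => p /=; rewrite scalerA.
Qed.

Lemma tscaleDr : right_distributive tscale +%R.
Proof.
move=> c; elim/tensorW=> s; elim/tensorW=> t.
rewrite /GRing.add /= tadd_pi !tscale_pi.
by rewrite tadd_pi /tscale_seq map_cat.
Qed.

HB.instance Definition _ := GRing.Zmodule_isLmodule.Build k tensor
  tscaleA tscale1 tscaleDr tscaleDl.

Definition pure (a : A) (b : B) : tensor := tclass [:: (a, b)].

(* The value at t of the map induced by a *bilinear* F, read off on a chosen
   decomposition of t into pure tensors: this is Sweedler's notation.  It does
   not depend on the decomposition when F is bilinear (tsum_pi); it should not
   be used for any other F. *)
Definition tsum (W : nmodType) (F : A -> B -> W) (t : tensor) : W :=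
  \sum_(p <- repr t) F p.1 p.2.

Lemma pure_bilinear : is_bilinear pure.
Proof.
have piD s t : tclass (s ++ t) = tclass s + tclass t.
  by rewrite -tadd_pi.
have piZ c a b : tclass [:: (c *: a, b)] = c *: tclass [:: (a, b)].
  by rewrite [RHS]tscale_pi.
split=> [b c a a'|a c b b'] /=; rewrite /pure.
  rewrite -piZ -piD; exact/tensor_piP/tensor_addl.
rewrite -piZ -piD; apply/tensor_piP.
apply: tensor_trans (tensor_addr _ _ _) _.
apply: (@tensor_cat [:: _] [:: _] [:: _] [:: _]); last exact: tensor_refl.
exact/tensor_sym/tensor_scale.
Qed.

Lemma tensor_sum (t : tensor) : t = \sum_(p <- repr t) pure p.1 p.2.
Proof.
rewrite -[LHS]tclassK; elim: (repr t) => [|[a b] s IHs]; first by rewrite big_nil.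
by rewrite big_cons -IHs -cat1s -tadd_pi.
Qed.

Section Lift.
Variables (W : lmodType k) (F : A -> B -> W).
Hypothesis bilF : is_bilinear F.

Let FDl a a' b : F (a + a') b = F a b + F a' b.
Proof. by have := bilF.1 b 1 a a'; rewrite !scale1r. Qed.
Let FDr a b b' : F a (b + b') = F a b + F a b'.
Proof. by have := bilF.2 a 1 b b'; rewrite !scale1r. Qed.
Let F0l b : F 0 b = 0.
Proof. by apply: (addrI (F 0 b)); rewrite -FDl !addr0. Qed.
Let F0r a : F a 0 = 0.
Proof. by apply: (addrI (F a 0)); rewrite -FDr !addr0. Qed.
Let FZl c a b : F (c *: a) b = c *: F a b.
Proof. by have := bilF.1 b c a 0; rewrite !addr0 F0l addr0. Qed.
Let FZr c a b : F a (c *: b) = c *: F a b.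
Proof. by have := bilF.2 a c b 0; rewrite !addr0 F0r addr0. Qed.

Lemma tsum_pi s : tsum F (tclass s) = \sum_(p <- s) F p.1 p.2.
Proof.
rewrite /tsum; move: (repr _) (tensor_repr s) => t; elim=> {s t} //=.
- by move=> s t u _ -> _ ->.
- by move=> s s' t t' _ E _ E'; rewrite !big_cat /= E E'.
- by move=> s t; rewrite !big_cat /= addrC.
- by move=> b; rewrite big_seq1 big_nil /= F0l.
- by move=> a a' b; rewrite !big_cons !big_nil !addr0 /= FDl.
- by move=> a b b'; rewrite !big_cons !big_nil !addr0 /= FDr.
- by move=> c a b; rewrite !big_seq1 /= FZl FZr.
Qed.

Lemma tsum_pure a b : tsum F (pure a b) = F a b.
Proof. by rewrite tsum_pi big_seq1. Qed.

Lemma tsum_linear : linear (tsum F).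
Proof.
move=> c; elim/tensorW=> s; elim/tensorW=> t.
have -> : c *: tclass s + tclass t = tclass (tscale_seq c s ++ t).
  by rewrite -tadd_pi -tscale_pi.
rewrite !tsum_pi big_cat /= /tscale_seq big_map scaler_sumr; congr (_ + _).
by apply: eq_bigr => p _; rewrite FZl.
Qed.

End Lift.
End Tensor.

Notation "A ⊗ B" := (tensor A%type B%type) : type_scope.
Notation "a ⊗ b" := (pure a b) : ring_scope.
Notation "\sw_ ( a , b <- t ) F" := (tsum (fun a b => F) t) : ring_scope.

(* Bialgebra structures are kept as data on a module, separate from their
   axioms, because one module carries several multiplications below.  The
   multiplication is a plain binary operation rather than a ringType instance
   for that reason, and so that the zero ring k is not excluded. *)
Section Structures.
Variable k : comPzRingType.

Record coalgebra (V : lmodType k) := Coalgebra {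
  comul : {linear V -> (V ⊗ V)%type};
  counit : {scalar V}
}.

Record bialgebra (V : lmodType k) := Bialgebra {
  coalg :> coalgebra V;
  bmul : V -> V -> V;
  bone : V
}.

Definition is_coalgebra (V : lmodType k) (C : coalgebra V) : Prop :=
  [/\ forall c,
        \sw_(x, y <- comul C c) \sw_(y1, y2 <- comul C y) (x ⊗ (y1 ⊗ y2))
      = \sw_(x, y <- comul C c) \sw_(x1, x2 <- comul C x) (x1 ⊗ (x2 ⊗ y)),
      forall c, \sw_(x, y <- comul C c) (counit C x *: y) = c
    & forall c, \sw_(x, y <- comul C c) (counit C y *: x) = c].

Definition is_algebra (V : lmodType k) (B : bialgebra V) : Prop :=
  [/\ is_bilinear (bmul B), associative (bmul B),
      left_id (bone B) (bmul B) & right_id (bone B) (bmul B)].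

Definition is_bialgebra (V : lmodType k) (B : bialgebra V) : Prop :=
  [/\ is_coalgebra B, is_algebra B,
      (forall x y, comul B (bmul B x y)
        = \sw_(x1, x2 <- comul B x) \sw_(y1, y2 <- comul B y)
            (bmul B x1 y1 ⊗ bmul B x2 y2))
        /\ comul B (bone B) = bone B ⊗ bone B
    & (forall x y, counit B (bmul B x y) = counit B x * counit B y)
        /\ counit B (bone B) = 1].

Definition is_antipode (V : lmodType k) (B : bialgebra V) (S : V -> V) : Prop :=
  [/\ linear S,
      forall x, \sw_(x1, x2 <- comul B x) bmul B (S x1) x2
        = counit B x *: bone B
    & forall x, \sw_(x1, x2 <- comul B x) bmul B x1 (S x2)
        = counit B x *: bone B].

Definition is_hopf_with (V : lmodType k) (B : bialgebra V) (S : V -> V) : Prop :=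
  is_bialgebra B /\ is_antipode B S.

Definition is_hopf (V : lmodType k) (B : bialgebra V) : Prop :=
  exists S, is_hopf_with B S.

Definition coalgebra_morphism (V W : lmodType k)
    (C : coalgebra V) (D : coalgebra W) (f : V -> W) : Prop :=
  [/\ linear f,
      forall x, comul D (f x) = \sw_(x1, x2 <- comul C x) (f x1 ⊗ f x2)
    & forall x, counit D (f x) = counit C x].

(* Between Hopf algebras these automatically commute with the antipodes. *)
Definition hopf_morphism (V W : lmodType k)
    (B : bialgebra V) (D : bialgebra W) (f : V -> W) : Prop :=
  [/\ coalgebra_morphism B D f,
      {morph f : x y / bmul B x y >-> bmul D x y}
    & f (bone B) = bone D].

Definition hopf_isomorphic (V W : lmodType k)
    (B : bialgebra V) (D : bialgebra W) : Prop :=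
  exists2 f : V -> W, hopf_morphism B D f & bijective f.

(* The inclusion of a Hopf subalgebra is given by the map i; the linear
   splitting p makes it injective. *)
Definition hopf_subalgebra (E A : lmodType k)
    (BE : bialgebra E) (BA : bialgebra A) (i : A -> E) : Prop :=
  [/\ is_hopf BE, is_hopf BA, hopf_morphism BA BE i
    & exists p : {linear E -> A}, cancel i p].

Definition mult_map (E A H : lmodType k) (BE : bialgebra E)
    (iA : A -> E) (iH : H -> E) (t : A ⊗ H) : E :=
  \sw_(a, h <- t) bmul BE (iA a) (iH h).

Definition is_complement (E A H : lmodType k) (BE : bialgebra E)
    (BA : bialgebra A) (iA : A -> E) (BH : bialgebra H) (iH : H -> E) : Prop :=
  [/\ hopf_subalgebra BE BA iA, hopf_subalgebra BE BH iH
    & bijective (mult_map BE iA iH)].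

Section CanonicalMatchedPair.
Variables (E A H : lmodType k).
Variables (BE : bialgebra E) (BA : bialgebra A) (BH : bialgebra H).
Variables (iA : A -> E) (iH : H -> E).

(* The inverse of the multiplication map when that map is bijective, the only
   case in which the two actions below are meaningful. *)
Definition mult_inv (x : E) : A ⊗ H :=
  xget 0 [set t | mult_map BE iA iH t = x]%classic.

Definition canonical_lact (h : H) (a : A) : A :=
  \sw_(b, g <- mult_inv (bmul BE (iH h) (iA a))) (counit BH g *: b).

Definition canonical_ract (h : H) (a : A) : H :=
  \sw_(b, g <- mult_inv (bmul BE (iH h) (iA a))) (counit BA b *: g).

End CanonicalMatchedPair.

Section TensorCoalgebra.
Variables (A H : lmodType k) (CA : coalgebra A) (CH : coalgebra H).

Definition tcomul (t : A ⊗ H) : (A ⊗ H) ⊗ (A ⊗ H) :=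
  \sw_(a, h <- t) \sw_(a1, a2 <- comul CA a) \sw_(h1, h2 <- comul CH h)
    ((a1 ⊗ h1) ⊗ (a2 ⊗ h2)).

Definition tcounit (t : A ⊗ H) : k :=
  \sw_(a, h <- t) (counit CA a * counit CH h).

Fact tcomul_is_linear : linear tcomul.
Proof.
have bil4 a1 a2 :
    is_bilinear (fun h1 h2 : H => (a1 ⊗ h1) ⊗ (a2 ⊗ h2) : (A ⊗ H) ⊗ (A ⊗ H)).
  split=> [h c x y|h c x y] /=.
    by rewrite (pure_bilinear A H).2 (pure_bilinear _ _).1.
  by rewrite (pure_bilinear A H).2 (pure_bilinear _ _).2.
have bil3 h : is_bilinear (fun a1 a2 : A =>
    \sw_(h1, h2 <- comul CH h) ((a1 ⊗ h1) ⊗ (a2 ⊗ h2))).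
  split=> [a2 c x y|a1 c x y]; rewrite /tsum scaler_sumr -big_split /=;
    apply: eq_bigr => p _.
    by rewrite (pure_bilinear A H).1 (pure_bilinear _ _).1.
  by rewrite (pure_bilinear A H).1 (pure_bilinear _ _).2.
apply: tsum_linear; split=> [h c x y|a c x y] /=.
  by rewrite linearP (tsum_linear (bil3 h)).
rewrite /tsum scaler_sumr -big_split; apply: eq_bigr => p _ /=.
by rewrite linearP; exact: (tsum_linear (bil4 p.1 p.2)).
Qed.
HB.instance Definition _ :=
  GRing.isLinear.Build k (A ⊗ H)%type ((A ⊗ H) ⊗ (A ⊗ H))%type _ tcomul
    tcomul_is_linear.

Fact tcounit_is_scalar : scalar tcounit.
Proof.
apply: (@tsum_linear k A H k^o); split=> [h c x y|a c x y] /=.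
  by rewrite linearP mulrDl -mulrA.
by rewrite linearP mulrDr mulrCA.
Qed.
HB.instance Definition _ :=
  GRing.isLinear.Build k (A ⊗ H)%type k *%R tcounit tcounit_is_scalar.

Definition tensor_coalgebra : coalgebra (A ⊗ H)%type :=
  Coalgebra tcomul tcounit.

End TensorCoalgebra.

Section Bicrossed.
Variables (A H : lmodType k) (BA : bialgebra A) (BH : bialgebra H).
Variables (lact : H -> A -> A) (ract : H -> A -> H).

Definition bicrossed_mul (s t : A ⊗ H) : A ⊗ H :=
  \sw_(a, h <- s) \sw_(c, g <- t)
  \sw_(h1, h2 <- comul BH h) \sw_(c1, c2 <- comul BA c)
    (bmul BA a (lact h1 c1) ⊗ bmul BH (ract h2 c2) g).

Definition bicrossed : bialgebra (A ⊗ H)%type :=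
  Bialgebra (tensor_coalgebra BA BH) bicrossed_mul (bone BA ⊗ bone BH).

Definition deformation_map (r : H -> A) : Prop :=
  [/\ coalgebra_morphism BH BA r,
      r (bone BH) = bone BA,
      forall h, \sw_(h1, h2 <- comul BH h) (r h1 ⊗ h2)
              = \sw_(h1, h2 <- comul BH h) (r h2 ⊗ h1)
    & forall g h,
        r (\sw_(g1, g2 <- comul BH g) bmul BH (ract h (r g1)) g2)
      = \sw_(h1, h2 <- comul BH h) bmul BA (r h1) (lact h2 (r g))].

Definition deformed_mul (r : H -> A) (h g : H) : H :=
  \sw_(g1, g2 <- comul BH g) bmul BH (ract h (r g1)) g2.

(* Same underlying coalgebra as H. *)
Definition deformed (r : H -> A) : bialgebra H :=
  Bialgebra BH (deformed_mul r) (bone BH).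

Definition deformed_antipode (SA : A -> A) (SH : H -> H) (r : H -> A)
    (h : H) : H :=
  \sw_(h1, h2 <- comul BH h) ract (SH h2) (SA (r h1)).

End Bicrossed.

Section DeformationGraph.
Variables (A H : lmodType k) (CH : coalgebra H) (r : {linear H -> A}).

Definition graph_map (h : H) : A ⊗ H :=
  \sw_(h1, h2 <- comul CH h) (r h1 ⊗ h2).

Fact graph_map_is_linear : linear graph_map.
Proof.
have bil : is_bilinear (fun h1 h2 : H => r h1 ⊗ h2).
  split=> [h2 c x y|h1 c x y] /=; last by rewrite (pure_bilinear _ _).2.
  by rewrite linearP (pure_bilinear _ _).1.
by move=> c x y; rewrite /graph_map linearP (tsum_linear bil).
Qed.
HB.instance Definition _ :=
  GRing.isLinear.Build k H (A ⊗ H)%type _ graph_map graph_map_is_linear.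

End DeformationGraph.
End Structures.

(* The image of a linear map, as a module. *)
Section Image.
Variables (k : comPzRingType) (U V : lmodType k) (f : {linear U -> V}).

Definition image_pred : {pred V} := [pred v | `[< exists u, f u = v >]].

Fact image_submod_closed : submod_closed image_pred.
Proof.
split=> [|c _ _ /asboolP[u <-] /asboolP[v <-]]; apply/asboolP.
  by exists 0; rewrite linear0.
by exists (c *: u + v); rewrite linearP.
Qed.
HB.instance Definition _ :=
  GRing.isSubmodClosed.Build k V image_pred image_submod_closed.

Record image_of := ImageOf {
  image_val : V;
  image_valP : image_val \in image_pred
}.
HB.instance Definition _ := [isSub for image_val].
HB.instance Definition _ := [Choice of image_of by <:].
HB.instance Definition _ := [SubChoice_isSubLmodule of image_of by <:].

End Image.

(* Main.v *)
Require Import Defs.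
From HB Require Import structures.
From mathcomp Require Import all_boot all_algebra.
From mathcomp Require Import boolp classical_sets.

Set Implicit Arguments.
Unset Strict Implicit.
Unset Printing Implicit Defensive.

Import GRing.Theory.
Local Open Scope ring_scope.

(** Everything is computed inside [E].  Bijectivity of the multiplication map
    [m : A ⊗ H -> E] gives two projections of [E], namely
    [facA = (id ⊗ ε) m^-1] and [facH = (ε ⊗ id) m^-1].  They determine every
    element through [x = facA(x1) facH(x2)] ([factor_mult]), [facA] is left
    [A]-linear, [facH] is right [H]-linear, and the two canonical actions are
    [h ▷ a = facA(h a)] and [h ◁ a = facH(h a)].  Applying [factor_mult] to
    [h a] shows that [m] turns the bicrossed product into the product of [E],
    so [m] is an isomorphism of Hopf algebras.

    The deformation is governed by the map [graph : H -> E],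
    [graph h = r(h1) h2], which is [m] composed with [f_r].  Cocentrality of
    [r] is exactly what makes it a coalgebra map
    ([graph_coalgebra_morphism]), and [facH] is a retraction of it
    ([facH_graph]).  The deformed product is the product of [E] seen through
    this retraction: [facH(x graph(g)) = facH(x) • g] ([facH_mul_graph]).  The
    defining equation of a deformation map says that the other projection is
    [facA(graph(h) graph(g)) = r(h • g)]; feeding both projections into
    [factor_mult] gives [graph(h) graph(g) = graph(h • g)] ([graph_mul]).
    Since [graph] is an injective map of coalgebras and of algebras, [H_r]
    inherits all bialgebra axioms from [E].

    For the antipode, [S_H(h2) S_A(r(h1))] and [S_E(graph h)] are both
    convolution inverses of [graph], hence equal, so the proposed antipode is
    [S(h) = facH(S_E(graph h))].  By [facH_mul_graph] it is a left
    convolution inverse of the identity; then [graph ∘ S] and [S_E ∘ graph]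
    are convolution inverses of [graph] on the two sides, so they agree, and
    injectivity of [graph] gives the right inverse property
    ([deformed_is_antipode]).

    Finally [a ⊗ h |-> a graph(h)] is [m] composed with the shear
    [a ⊗ h |-> a r(h1) ⊗ h2], whose inverse is the shear by [S_A ∘ r]
    ([shear_bijective]); hence [graph] makes [H_r] an [A]-complement of [E].
    The image of [f_r] receives its structure along the bijection with [H_r],
    and both complement claims follow by transport along isomorphisms
    ([complement_isor], [complement_isol]). *)

(** * Sweedler calculus *)

Section Linearity.
Variable k : comPzRingType.
Implicit Types U V W X : lmodType k.

Lemma linear_idfun U : linear (fun x : U => x).
Proof. by []. Qed.

Lemma linear_comp U V W (g : V -> W) (f : U -> V) :
  linear g -> linear f -> linear (fun x => g (f x)).
Proof. by move=> gl fl c x y; rewrite fl gl. Qed.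

Lemma scalar_comp U V (g : V -> k) (f : U -> V) :
  scalar g -> linear f -> scalar (fun x => g (f x)).
Proof. by move=> gl fl c x y; rewrite fl gl. Qed.

Lemma linear_bilinearl U V W X (F : V -> W -> X) (f : U -> V) w :
  is_bilinear F -> linear f -> linear (fun x => F (f x) w).
Proof. by case=> Fl _; apply: (linear_comp (Fl w)). Qed.

Lemma linear_bilinearr U V W X (F : V -> W -> X) (f : U -> W) v :
  is_bilinear F -> linear f -> linear (fun x => F v (f x)).
Proof. by case=> _ Fr; apply: (linear_comp (Fr v)). Qed.

Lemma linear_scalel U V (s : U -> k) (v : V) :
  scalar s -> linear (fun x => s x *: v).
Proof. by move=> sl c x y; rewrite sl scalerDl scalerA. Qed.

Lemma linear_scaler U V (f : U -> V) c :
  linear f -> linear (fun x => c *: f x).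
Proof. by move=> fl d x y; rewrite fl scalerDr !scalerA mulrC. Qed.

Lemma scalar_mull U (s : U -> k) c : scalar s -> scalar (fun x => s x * c).
Proof. by move=> sl d x y; rewrite sl mulrDl mulrA. Qed.

Lemma scalar_mulr U (s : U -> k) c : scalar s -> scalar (fun x => c * s x).
Proof. by move=> sl d x y; rewrite sl mulrDr mulrCA. Qed.

Lemma linear_tsum_fun U V W X (F : U -> V -> W -> X) t :
  (forall v w, linear (fun x => F x v w)) -> linear (fun x => tsum (F x) t).
Proof.
move=> Fl c x y; rewrite /tsum scaler_sumr -big_split /=.
by apply: eq_bigr => p _; rewrite Fl.
Qed.

Lemma linear_tsum_arg U V W X (F : V -> W -> X) (f : U -> (V ⊗ W)%type) :
  is_bilinear F -> linear f -> linear (fun x => tsum F (f x)).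
Proof. by move=> Fl fl; apply: linear_comp fl; apply: tsum_linear. Qed.

Definition is_trilinear U V W X (F : U -> V -> W -> X) :=
  [/\ forall v w, linear (fun u => F u v w),
      forall u w, linear (fun v => F u v w)
    & forall u v, linear (fun w => F u v w)].

End Linearity.

(** Every rewriting of a Sweedler sum is licensed by the (multi)linearity of
    its summand.  These tactics decide such side conditions by following the
    syntax of the summand down to maps whose linearity is a hypothesis in the
    context or a canonical instance. *)
Ltac linear_leaf :=
  solve [ assumption | apply: linear_idfun | apply: linearP
        | apply: pure_bilinear | apply: (pure_bilinear _ _).1
        | apply: (pure_bilinear _ _).2
        | match goal with
          | H : is_bilinear ?F |- GRing.linear_for _ (?F ?u) => exact: (H.2 u)
          end ].

Ltac linear_step :=
  first [ linear_leaf |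
  match goal with
  | |- is_trilinear _ => split; intros; cbv beta
  | |- is_bilinear _ => split; intro; cbv beta
  | |- GRing.linear_for _ (tsum _) => apply: tsum_linear
  | |- GRing.linear_for _ (fun x => (@?s x) *: ?v) =>
      apply: (@linear_scalel _ _ _ s v)
  | |- GRing.linear_for _ (fun x => ?c *: (@?f x)) =>
      apply: (@linear_scaler _ _ _ f c)
  | |- GRing.linear_for _ (fun x => (@?s x) * ?c) =>
      apply: (@scalar_mull _ _ s c)
  | |- GRing.linear_for _ (fun x => ?c * (@?s x)) =>
      apply: (@scalar_mulr _ _ s c)
  | |- GRing.linear_for _ (fun x => tsum (@?F x) ?t) =>
      apply: (@linear_tsum_fun _ _ _ _ _ F t); intros; cbv beta
  | |- GRing.linear_for _ (fun x => tsum ?F (@?f x)) =>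
      apply: (@linear_tsum_arg _ _ _ _ _ F f)
  | |- GRing.linear_for _ (fun x => pure (@?f x) ?b) =>
      apply: (linear_bilinearl (f := f) b (pure_bilinear _ _))
  | |- GRing.linear_for _ (fun x => pure ?a (@?f x)) =>
      apply: (linear_bilinearr (f := f) a (pure_bilinear _ _))
  | H : is_bilinear ?F |- GRing.linear_for _ (fun x => ?F (@?f x) ?b) =>
      apply: (linear_bilinearl (f := f) b H)
  | H : is_bilinear ?F |- GRing.linear_for _ (fun x => ?F ?a (@?f x)) =>
      apply: (linear_bilinearr (f := f) a H)
  | |- @GRing.linear_for ?R ?U ?V (@GRing.mul _) (fun x => ?L (@?f x)) =>
      apply: (@scalar_comp _ _ _ L f); [ linear_leaf | ]
  | |- GRing.linear_for _ (fun x => ?L (@?f x)) =>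
      apply: (@linear_comp _ _ _ _ L f); [ linear_leaf | ]
  end ].

Ltac linearity := repeat linear_step.

Section TensorCalculus.
Variable k : comPzRingType.
Implicit Types U V W X Y : lmodType k.

Lemma eq_tsum U V (X : nmodType) (F G : U -> V -> X) (t : U ⊗ V) :
  (forall a b, F a b = G a b) -> tsum F t = tsum G t.
Proof. by move=> FG; apply: eq_bigr => p _; apply: FG. Qed.

Lemma linear_tsum U V W X (L : W -> X) (F : U -> V -> W) (t : U ⊗ V) :
  linear L -> L (tsum F t) = tsum (fun a b => L (F a b)) t.
Proof.
move=> Ll.
pose L' : {linear W -> X} := HB.pack L (GRing.isLinear.Build _ _ _ _ L Ll).
by rewrite -[L _]/(L' _) /tsum linear_sum.
Qed.

Lemma linear_scale U V (f : U -> V) c x : linear f -> f (c *: x) = c *: f x.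
Proof. by move=> fl; exact: (GRing.scalable_linear fl). Qed.

Lemma bilinear_scalel U V W (F : U -> V -> W) c x y :
  is_bilinear F -> F (c *: x) y = c *: F x y.
Proof. by case=> Fl _; apply: (linear_scale _ _ (Fl y)). Qed.

Lemma bilinear_scaler U V W (F : U -> V -> W) c x y :
  is_bilinear F -> F x (c *: y) = c *: F x y.
Proof. by case=> _ Fr; apply: (linear_scale _ _ (Fr x)). Qed.

Lemma scalar_scale U (f : U -> k) c x : scalar f -> f (c *: x) = c * f x.
Proof. by move=> fl; exact: (GRing.scalable_linear fl). Qed.

Lemma scale_tsum U V W c (F : U -> V -> W) (t : U ⊗ V) :
  c *: tsum F t = tsum (fun a b => c *: F a b) t.
Proof. exact: scaler_sumr. Qed.

Lemma scalar_tsum U V W (L : W -> k) (F : U -> V -> W) (t : U ⊗ V) :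
  scalar L -> L (tsum F t) = tsum (fun a b => L (F a b)) t.
Proof. exact: (@linear_tsum U V W k^o). Qed.

Lemma tsum_tsum U V W X Y (F : W -> X -> Y) (G : U -> V -> (W ⊗ X)%type)
    (t : U ⊗ V) : is_bilinear F ->
  tsum F (tsum G t) = tsum (fun a b => tsum F (G a b)) t.
Proof. by move=> Fb; apply: linear_tsum; linearity. Qed.

Lemma tsum_pure_id U V (t : U ⊗ V) : \sw_(a, b <- t) (a ⊗ b) = t.
Proof. by rewrite [RHS]tensor_sum. Qed.

Lemma eq_linear_tensor U V W (f g : (U ⊗ V)%type -> W) :
  linear f -> linear g -> (forall a b, f (a ⊗ b) = g (a ⊗ b)) -> f =1 g.
Proof.
move=> fl gl fg t; rewrite -(tsum_pure_id t) !linear_tsum //.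
exact: eq_tsum.
Qed.

Lemma linear_inverse U V (f : U -> V) (g : V -> U) :
  linear f -> cancel f g -> cancel g f -> linear g.
Proof.
by move=> fl fK gK c x y; apply: (can_inj fK); rewrite fl !gK.
Qed.

Section Coalgebra.
Variables (V : lmodType k) (C : coalgebra V).
Hypothesis coalgC : is_coalgebra C.

(** The coassociativity axiom is stated for the universal trilinear map; any
    other one factors through it, by applying the induced linear map. *)
Lemma tsum_coassoc W (F : V -> V -> V -> W) c : is_trilinear F ->
    \sw_(x, y <- comul C c) \sw_(y1, y2 <- comul C y) F x y1 y2
  = \sw_(x, y <- comul C c) \sw_(x1, x2 <- comul C x) F x1 x2 y.
Proof.
case: coalgC => coassocC _ _ [F1 F2 F3].
have Fb u : is_bilinear (F u) by split=> [w|v]; [apply: F2 | apply: F3].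
have Ftl : is_bilinear (fun x => tsum (F x)).
  by split=> [t|x]; [apply: linear_tsum_fun | apply: tsum_linear].
have := congr1 (tsum (fun x => tsum (F x))) (coassocC c).
rewrite !tsum_tsum // => E; etransitivity; [|etransitivity; [exact: E|]].
  apply: eq_tsum => x y; rewrite tsum_tsum //; apply: eq_tsum => y1 y2.
  by rewrite !tsum_pure.
apply: eq_tsum => x y; rewrite tsum_tsum //; apply: eq_tsum => x1 x2.
by rewrite !tsum_pure.
Qed.

(** Four Sweedler factors, rebracketed from [(c1 c2)(c3 c4)] to
    [c1 ((c2 c3) c4)]: the two middle factors become the comultiplication of
    a single element, so that an identity on [comul] can be used on them. *)
Lemma tsum_coassoc4 W (F : V -> V -> V -> V -> W) c :
    (forall c1 c2, is_bilinear (F c1 c2)) ->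
    (forall c3 c4, is_bilinear (fun c1 c2 => F c1 c2 c3 c4)) ->
    \sw_(x, y <- comul C c) \sw_(c1, c2 <- comul C x)
      \sw_(c3, c4 <- comul C y) F c1 c2 c3 c4
  = \sw_(c1, y <- comul C c) \sw_(z, c4 <- comul C y)
      \sw_(c2, c3 <- comul C z) F c1 c2 c3 c4.
Proof.
move=> Frb Flb.
have F1 c2 c3 c4 : linear (fun c1 => F c1 c2 c3 c4) := (Flb c3 c4).1 c2.
have F2 c1 c3 c4 : linear (fun c2 => F c1 c2 c3 c4) := (Flb c3 c4).2 c1.
have F3 c1 c2 c4 : linear (fun c3 => F c1 c2 c3 c4) := (Frb c1 c2).1 c4.
rewrite -(@tsum_coassoc _
  (fun c1 c2 y => \sw_(c3, c4 <- comul C y) F c1 c2 c3 c4)) //; last first.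
  split=> u v; try by apply: linear_tsum_fun.
  by apply: linear_tsum_arg => //; exact: linearP.
apply: eq_tsum => c1 y.
rewrite (@tsum_coassoc _ (F c1)) //.
by split=> // u v; apply: (Frb c1 u).2.
Qed.

Lemma tsum_counitl W (f : V -> W) c : linear f ->
  \sw_(x, y <- comul C c) (counit C x *: f y) = f c.
Proof.
case: coalgC => _ counitlC _ fl; rewrite -[in RHS](counitlC c) linear_tsum //.
by apply: eq_tsum => x y; rewrite linear_scale.
Qed.

Lemma tsum_counitr W (f : V -> W) c : linear f ->
  \sw_(x, y <- comul C c) (counit C y *: f x) = f c.
Proof.
case: coalgC => _ _ counitrC fl; rewrite -[in RHS](counitrC c) linear_tsum //.
by apply: eq_tsum => x y; rewrite linear_scale.
Qed.

End Coalgebra.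

Section Morphisms.
Variables (V W X : lmodType k).

Lemma tsum_coalgebra_morphism (C : coalgebra V) (D : coalgebra W) f
    (F : W -> W -> X) c : coalgebra_morphism C D f -> is_bilinear F ->
  tsum F (comul D (f c)) = \sw_(x, y <- comul C c) F (f x) (f y).
Proof.
case=> _ -> _ Fb; rewrite tsum_tsum //.
by apply: eq_tsum => a b; rewrite tsum_pure.
Qed.

Lemma tsum_comul_mul (B : bialgebra V) (F : V -> V -> X) b c :
    is_bialgebra B -> is_bilinear F ->
  tsum F (comul B (bmul B b c)) = \sw_(b1, b2 <- comul B b)
    \sw_(c1, c2 <- comul B c) F (bmul B b1 c1) (bmul B b2 c2).
Proof.
case=> _ _ [-> _] _ Fb; rewrite tsum_tsum //; apply: eq_tsum => b1 b2.
by rewrite tsum_tsum //; apply: eq_tsum => c1 c2; rewrite tsum_pure.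
Qed.

Lemma tsum_comul_one (B : bialgebra V) (F : V -> V -> X) :
    is_bialgebra B -> is_bilinear F ->
  tsum F (comul B (bone B)) = F (bone B) (bone B).
Proof. by case=> _ _ [_ ->] _ Fb; rewrite tsum_pure. Qed.

End Morphisms.
End TensorCalculus.

(** * Convolution, antipodes and transport of structure *)

Section Convolution.
Variables (k : comPzRingType) (V W : lmodType k).
Variables (C : coalgebra V) (B : bialgebra W).
Hypotheses (coalgC : is_coalgebra C) (algB : is_algebra B).

Definition convolution (u v : V -> W) (c : V) : W :=
  \sw_(c1, c2 <- comul C c) bmul B (u c1) (v c2).

(** [u = u * (v * w) = (u * v) * w = w] in the convolution algebra. *)
Lemma convolution_inverse_unique u v w :
    linear u -> linear v -> linear w ->
    (forall c, convolution u v c = counit C c *: bone B) ->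
    (forall c, convolution v w c = counit C c *: bone B) ->
  u =1 w.
Proof.
move=> ul vl wl uv vw c; have [mulb mulA mul1 mulr1] := algB.
rewrite -[LHS](tsum_counitr coalgC) // -[RHS](tsum_counitl coalgC) //.
transitivity (\sw_(x, y <- comul C c) \sw_(y1, y2 <- comul C y)
    bmul B (u x) (bmul B (v y1) (w y2))).
  apply: eq_tsum => x y.
  rewrite -[RHS](linear_tsum (L := bmul B (u x))); last by linearity.
  rewrite -[X in bmul B _ X]/(convolution v w y) vw.
  by rewrite bilinear_scaler ?mulr1.
rewrite tsum_coassoc //; last by linearity.
apply: eq_tsum => x y.
transitivity (bmul B (convolution u v x) (w y)).
  rewrite [RHS](linear_tsum (L := (bmul B)^~ (w y))); last by linearity.
  by apply: eq_tsum => x1 x2; rewrite mulA.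
by rewrite uv bilinear_scalel ?mul1.
Qed.

End Convolution.

Section HopfMorphisms.
Variables (k : comPzRingType).
Implicit Types U V W : lmodType k.

(** Precomposition with a coalgebra map preserves convolution inverses, and
    the antipode is the convolution inverse of the identity. *)
Lemma antipode_coalgebra_morphism V W (C : coalgebra V) (B : bialgebra W) S f :
    is_algebra B -> is_antipode B S -> coalgebra_morphism C B f ->
    (forall c, convolution C B (fun x => S (f x)) f c = counit C c *: bone B)
  /\ (forall c, convolution C B f (fun x => S (f x)) c = counit C c *: bone B).
Proof.
move=> [mulb _ _ _] [Sl SI IS] fC; have [fl _ f_counit] := fC.
rewrite /convolution; split=> c; rewrite -f_counit.
  rewrite -SI.
  rewrite (tsum_coalgebra_morphism (F := fun x y => bmul B (S x) y) _ fC) //.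
  by linearity.
rewrite -IS.
rewrite (tsum_coalgebra_morphism (F := fun x y => bmul B x (S y)) _ fC) //.
by linearity.
Qed.

Lemma coalgebra_morphism_comp U V W (B : coalgebra U) (C : coalgebra V)
    (D : coalgebra W) g f :
    coalgebra_morphism C D g -> coalgebra_morphism B C f ->
  coalgebra_morphism B D (fun x => g (f x)).
Proof.
move=> [gl gC g_counit] fC; have [fl _ f_counit] := fC.
split=> [|x|x]; first by linearity.
  by rewrite gC (tsum_coalgebra_morphism _ fC) //; linearity.
by rewrite g_counit f_counit.
Qed.

Lemma hopf_morphism_comp U V W (B : bialgebra U) (C : bialgebra V)
    (D : bialgebra W) g f :
    hopf_morphism C D g -> hopf_morphism B C f ->
  hopf_morphism B D (fun x => g (f x)).
Proof.
move=> [gC gM g1] [fC fM f1]; split; last by rewrite f1 g1.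
  exact: coalgebra_morphism_comp gC fC.
by move=> x y; rewrite fM gM.
Qed.

Section Inverse.
Variables (V W : lmodType k) (f : V -> W) (g : W -> V).
Hypotheses (fK : cancel f g) (gK : cancel g f).

Lemma coalgebra_morphism_inverse (C : coalgebra V) (D : coalgebra W) :
  coalgebra_morphism C D f -> coalgebra_morphism D C g.
Proof.
move=> fC; have [fl _ f_counit] := fC; have gl := linear_inverse fl fK gK.
split=> // y; rewrite -{2}(gK y).
  rewrite (tsum_coalgebra_morphism _ fC); last by linearity.
  by rewrite -[LHS]tsum_pure_id; apply: eq_tsum => a b; rewrite !fK.
by rewrite f_counit.
Qed.

Lemma hopf_morphism_inverse (B : bialgebra V) (D : bialgebra W) :
  hopf_morphism B D f -> hopf_morphism D B g.
Proof.
move=> [fC fM f1]; split; last by rewrite -f1 fK.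
  exact: coalgebra_morphism_inverse fC.
by move=> x y; apply: (can_inj fK); rewrite fM !gK.
Qed.

(** The structure of [D] is determined by that of [B] through the bijection
    [f], so each axiom of [D] at [f x] is the image under [f] of the axiom of
    [B] at [x].  Bilinearity of the product of [D], which is not part of being
    a morphism, comes from the formula [y z = f (g(y) g(z))]. *)
Lemma hopf_transport (B : bialgebra V) (D : bialgebra W) S :
    is_hopf_with B S -> hopf_morphism B D f ->
  is_hopf_with D (fun y => f (S (g y))).
Proof.
move=> [[coalgB algB [mulC oneC] [mul_counit one_counit]] [Sl SI IS]].
move=> fM; have [gC gM g1] := hopf_morphism_inverse fM.
have [fC {}fM f1] := fM; have [fl comulf f_counit] := fC.
have [gl _ g_counit] := gC; have [mulb mulA mul1 mulr1] := algB.
have mulE x y : bmul D x y = f (bmul B (g x) (g y)) by rewrite fM !gK.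
have Db : is_bilinear (bmul D).
  split=> [y c x x'|x c y y'].
    by rewrite !mulE gl -[RHS]fl -(mulb.1 (g y)).
  by rewrite !mulE gl -[RHS]fl -(mulb.2 (g x)).
have tsumf (X : lmodType k) (F : W -> W -> X) c : is_bilinear F ->
    tsum F (comul D (f c)) = \sw_(x, y <- comul B c) F (f x) (f y).
  exact: tsum_coalgebra_morphism fC.
split; [split|split].
- split=> c; rewrite -(gK c); rewrite !tsumf; try by linearity.
  + transitivity (\sw_(x, y <- comul B (g c)) \sw_(y1, y2 <- comul B y)
      (f x ⊗ (f y1 ⊗ f y2))).
      by apply: eq_tsum => x y; rewrite tsumf //; linearity.
    rewrite tsum_coassoc //; last by linearity.
    by apply: eq_tsum => x y; rewrite tsumf //; linearity.
  + rewrite -(tsum_counitl coalgB _ fl).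
    by apply: eq_tsum => x y; rewrite f_counit.
  + rewrite -(tsum_counitr coalgB _ fl).
    by apply: eq_tsum => x y; rewrite f_counit.
- split=> //.
  + by move=> x y z; rewrite !mulE !fK mulA.
  + by move=> x; rewrite mulE -f1 fK mul1 gK.
  + by move=> x; rewrite mulE -f1 fK mulr1 gK.
- split; last by rewrite -f1 comulf oneC tsum_pure //; linearity.
  move=> x y; rewrite mulE comulf tsum_comul_mul //; last by linearity.
  rewrite -{2}(gK x) tsumf; last by linearity.
  apply: eq_tsum => a b; rewrite -{2}(gK y) tsumf; last by linearity.
  by apply: eq_tsum => c d; rewrite !fM.
- split; last by rewrite -f1 f_counit.
  by move=> x y; rewrite mulE f_counit mul_counit !g_counit.
- by linearity.
- move=> y; rewrite -{1}(gK y) tsumf; last by linearity.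
  rewrite -g_counit -f1 -(linear_scale _ _ fl) -SI linear_tsum //.
  by apply: eq_tsum => a b; rewrite fK fM.
- move=> y; rewrite -{1}(gK y) tsumf; last by linearity.
  rewrite -g_counit -f1 -(linear_scale _ _ fl) -IS linear_tsum //.
  by apply: eq_tsum => a b; rewrite fK fM.
Qed.

End Inverse.
End HopfMorphisms.

(** * Factorizable Hopf algebras *)

Section Factorization.
Variables (k : comPzRingType) (E A H : lmodType k).
Variables (BE : bialgebra E) (BA : bialgebra A) (BH : bialgebra H).
Variables (iA : A -> E) (iH : H -> E).
Hypothesis complH : is_complement BE BA iA BH iH.

Local Notation m := (mult_map BE iA iH).
Local Notation m' := (mult_inv BE iA iH).

Let bialgE : is_bialgebra BE. Proof. by case: complH => [[[S []]]]. Qed.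
Let bialgA : is_bialgebra BA. Proof. by case: complH => [[_ [S []]]]. Qed.
Let bialgH : is_bialgebra BH. Proof. by case: complH => [_ [_ [S []]]]. Qed.
Let iA_morph : hopf_morphism BA BE iA. Proof. by case: complH => [[]]. Qed.
Let iH_morph : hopf_morphism BH BE iH. Proof. by case: complH => [_ []]. Qed.
Let mult_bij : bijective (mult_map BE iA iH). Proof. by case: complH. Qed.
Let mulEb : is_bilinear (bmul BE). Proof. by case: bialgE => _ []. Qed.
Let mulAb : is_bilinear (bmul BA). Proof. by case: bialgA => _ []. Qed.
Let mulHb : is_bilinear (bmul BH). Proof. by case: bialgH => _ []. Qed.
Let mulEA : associative (bmul BE). Proof. by case: bialgE => _ []. Qed.
Let iAl : linear iA. Proof. by case: iA_morph => [[]]. Qed.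
Let iHl : linear iH. Proof. by case: iH_morph => [[]]. Qed.
Let iAM x y : iA (bmul BA x y) = bmul BE (iA x) (iA y).
Proof. by case: iA_morph. Qed.
Let iHM x y : iH (bmul BH x y) = bmul BE (iH x) (iH y).
Proof. by case: iH_morph. Qed.
Let iAZ c x : iA (c *: x) = c *: iA x. Proof. exact: linear_scale. Qed.
Let iHZ c x : iH (c *: x) = c *: iH x. Proof. exact: linear_scale. Qed.
Let coalgA : is_coalgebra BA. Proof. by case: bialgA. Qed.
Let coalgH : is_coalgebra BH. Proof. by case: bialgH. Qed.

Lemma mult_map_pure a h : m (a ⊗ h) = bmul BE (iA a) (iH h).
Proof. by rewrite /mult_map tsum_pure //; linearity. Qed.

Lemma mult_map_linear : linear m.
Proof. by apply: tsum_linear; linearity. Qed.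
Let ml := mult_map_linear.

Lemma mult_invK : cancel m' m.
Proof.
case: mult_bij => n _ mn x; rewrite /mult_inv.
by apply: (@xgetPex _ 0 [set t | m t = x]%classic); exists (n x); apply: mn.
Qed.

Lemma mult_mapK : cancel m m'.
Proof. by move=> t; apply: (bij_inj mult_bij); rewrite mult_invK. Qed.

Lemma mult_inv_linear : linear m'.
Proof. exact: linear_inverse ml mult_mapK mult_invK. Qed.
Let m'l := mult_inv_linear.

(** The products [a h] generate [E] as a module, which reduces every linear
    identity on [E] below to a computation on such products. *)
Lemma eq_linear_mult (W : lmodType k) (f g : E -> W) :
    linear f -> linear g ->
    (forall a h, f (bmul BE (iA a) (iH h)) = g (bmul BE (iA a) (iH h))) ->
  f =1 g.
Proof.
move=> fl gl fg x; rewrite -(mult_invK x); move: (m' x) => t.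
apply: (eq_linear_tensor (f := fun t => f (m t)) (g := fun t => g (m t)));
  try by linearity.
by move=> a h; rewrite mult_map_pure.
Qed.

(** The two projections [(id ⊗ ε) m^-1] and [(ε ⊗ id) m^-1]; the canonical
    actions are, by definition, [facA (h a)] and [facH (h a)]. *)
Definition facA (x : E) : A := \sw_(b, g <- m' x) (counit BH g *: b).
Definition facH (x : E) : H := \sw_(b, g <- m' x) (counit BA b *: g).

Lemma facA_linear : linear facA.
Proof. by rewrite /facA; linearity. Qed.
Lemma facH_linear : linear facH.
Proof. by rewrite /facH; linearity. Qed.
Let facAl := facA_linear.
Let facHl := facH_linear.

Lemma facA_mult a h : facA (bmul BE (iA a) (iH h)) = counit BH h *: a.
Proof.
by rewrite -mult_map_pure /facA mult_mapK tsum_pure //; linearity.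
Qed.

Lemma facH_mult a h : facH (bmul BE (iA a) (iH h)) = counit BA a *: h.
Proof.
by rewrite -mult_map_pure /facH mult_mapK tsum_pure //; linearity.
Qed.

Lemma facA_mulA a x : facA (bmul BE (iA a) x) = bmul BA a (facA x).
Proof.
move: x; apply: eq_linear_mult; try by linearity.
move=> b h; rewrite mulEA -iAM !facA_mult.
by rewrite bilinear_scaler.
Qed.

Lemma facH_mulA a x : facH (bmul BE (iA a) x) = counit BA a *: facH x.
Proof.
move: x; apply: eq_linear_mult; try by linearity.
move=> b h; rewrite mulEA -iAM !facH_mult scalerA.
by case: bialgA => _ _ _ [-> _].
Qed.

Lemma facH_mulH x h : facH (bmul BE x (iH h)) = bmul BH (facH x) h.
Proof.
move: x; apply: eq_linear_mult; try by linearity.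
move=> a g; rewrite -mulEA -iHM !facH_mult.
by rewrite bilinear_scalel.
Qed.

Lemma facA_mulH x h : facA (bmul BE x (iH h)) = counit BH h *: facA x.
Proof.
move: x; apply: eq_linear_mult; try by linearity.
move=> a g; rewrite -mulEA -iHM !facA_mult scalerA mulrC.
by case: bialgH => _ _ _ [-> _].
Qed.

Lemma tsum_comul_mult (W : lmodType k) (F : E -> E -> W) a h :
    is_bilinear F ->
  tsum F (comul BE (bmul BE (iA a) (iH h)))
  = \sw_(a1, a2 <- comul BA a) \sw_(h1, h2 <- comul BH h)
      F (bmul BE (iA a1) (iH h1)) (bmul BE (iA a2) (iH h2)).
Proof.
move=> Fb; rewrite tsum_comul_mul //.
rewrite (tsum_coalgebra_morphism (C := BA)); first last.
- by linearity.
- by case: iA_morph.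
apply: eq_tsum => a1 a2; rewrite (tsum_coalgebra_morphism (C := BH)) //.
- by case: iH_morph.
- by linearity.
Qed.

(** On [x = a h] the two projections produce [ε(h1) a1] and [ε(a2) h2], and
    the counits collapse the sum to [a h]. *)
Lemma factor_mult x :
  \sw_(x1, x2 <- comul BE x) bmul BE (iA (facA x1)) (iH (facH x2)) = x.
Proof.
move: x; apply: eq_linear_mult; try by linearity.
move=> a h; rewrite tsum_comul_mult; last by linearity.
transitivity (\sw_(a1, a2 <- comul BA a) \sw_(h1, h2 <- comul BH h)
   (counit BA a2 *: (counit BH h1 *: bmul BE (iA a1) (iH h2)))).
  apply: eq_tsum => a1 a2; apply: eq_tsum => h1 h2.
  rewrite facA_mult facH_mult iAZ iHZ.
  by rewrite bilinear_scalel // bilinear_scaler // !scalerA mulrC.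
transitivity (\sw_(a1, a2 <- comul BA a)
   (counit BA a2 *: bmul BE (iA a1) (iH h))).
  apply: eq_tsum => a1 a2.
  rewrite -[bmul BE _ (iH h)](tsum_counitl coalgH h
    (f := fun h => bmul BE (iA a1) (iH h))); last by linearity.
  by rewrite scale_tsum.
rewrite (tsum_counitr coalgA a (f := fun a => bmul BE (iA a) (iH h))) //.
by linearity.
Qed.

Lemma facH_coalgebra_morphism : coalgebra_morphism BE BH facH.
Proof.
split=> // x.
  move: x; apply: eq_linear_mult; try by linearity.
  move=> a h; rewrite tsum_comul_mult; last by linearity.
  rewrite facH_mult (linear_scale _ _ (linearP (comul BH))).
  transitivity (\sw_(a1, a2 <- comul BA a)
     (counit BA a1 *: (counit BA a2 *: comul BH h))).
    rewrite (tsum_counitl coalgA a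
      (f := fun a => counit BA a *: comul BH h)) //.
    by linearity.
  apply: eq_tsum => a1 a2; rewrite -{1}(tsum_pure_id (comul BH h)).
  rewrite !scale_tsum; apply: eq_tsum => h1 h2.
  rewrite !facH_mult bilinear_scalel ?bilinear_scaler //;
  exact: pure_bilinear.
move: x; apply: (@eq_linear_mult k^o).
- by move=> c x y; rewrite facHl linearP.
- exact: linearP.
move=> a h; rewrite facH_mult (scalar_scale _ _ (linearP _)).
case: bialgE => _ _ _ [-> _].
by case: iA_morph => [[_ _ ->] _ _]; case: iH_morph => [[_ _ ->] _ _].
Qed.

Lemma mult_map_coalgebra_morphism :
  coalgebra_morphism (tensor_coalgebra BA BH) BE m.
Proof.
split=> // t.
  move: t; apply: eq_linear_tensor.
  - apply: linear_comp ml; exact: linearP.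
  - apply: (@linear_tsum_arg _ _ _ _ _ (fun x y => m x ⊗ m y)
      (comul (tensor_coalgebra BA BH))); last exact: linearP.
    by linearity.
  move=> a h; rewrite mult_map_pure -[LHS]tsum_pure_id tsum_comul_mult;
    last by linearity.
  rewrite /= /tcomul tsum_pure; last by linearity.
  rewrite tsum_tsum; last by linearity.
  apply: eq_tsum => a1 a2; rewrite tsum_tsum; last by linearity.
  apply: eq_tsum => h1 h2; rewrite tsum_pure; last by linearity.
  by rewrite !mult_map_pure.
move: t; apply: (@eq_linear_tensor k _ _ k^o).
- by move=> c x y; rewrite ml linearP.
- exact: linearP.
move=> a h; rewrite mult_map_pure /= /tcounit.
rewrite (tsum_pure (W := k^o)); last by split; intro; cbv beta; linearity.
case: bialgE => _ _ _ [-> _].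
by case: iA_morph => [[_ _ ->] _ _]; case: iH_morph => [[_ _ ->] _ _].
Qed.

Local Notation lact := (canonical_lact BE BH iA iH).
Local Notation ract := (canonical_ract BE BA iA iH).

Let lactE h a : lact h a = facA (bmul BE (iH h) (iA a)). Proof. by []. Qed.

(** In [(a h) (c g)] the middle part [h c] is refactored by [factor_mult] as
    [(h1 ▷ c1) (h2 ◁ c2)], which is the product of the bicrossed product. *)
Lemma mult_map_mul s t :
  m (bicrossed_mul BA BH lact ract s t) = bmul BE (m s) (m t).
Proof.
rewrite [in RHS]/mult_map (linear_tsum (L := (bmul BE)^~ _)); last by linearity.
rewrite linear_tsum //; apply: eq_tsum => a h.
rewrite [RHS](linear_tsum (L := bmul BE _)); last by linearity.
rewrite linear_tsum //; apply: eq_tsum => c g.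
transitivity (bmul BE (bmul BE (iA a) (bmul BE (iH h) (iA c))) (iH g));
  last by rewrite !mulEA.
rewrite -[bmul BE (iH h) _]factor_mult tsum_comul_mul //; last by linearity.
rewrite (tsum_coalgebra_morphism (C := BH)); first last.
- by linearity.
- by case: iH_morph.
rewrite (linear_tsum (L := fun x => bmul BE (bmul BE _ x) _));
  last by linearity.
rewrite linear_tsum //; apply: eq_tsum => h1 h2.
rewrite (tsum_coalgebra_morphism (C := BA)); first last.
- by linearity.
- by case: iA_morph.
rewrite (linear_tsum (L := fun x => bmul BE (bmul BE _ x) _));
  last by linearity.
rewrite linear_tsum //; apply: eq_tsum => c1 c2.
by rewrite mult_map_pure iAM iHM !mulEA.
Qed.

Lemma mult_map_hopf_morphism :
  hopf_morphism (bicrossed BA BH lact ract) BE m.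
Proof.
split; [exact: mult_map_coalgebra_morphism | exact: mult_map_mul |].
rewrite mult_map_pure; have [_ _ ->] := iA_morph; have [_ _ ->] := iH_morph.
by case: bialgE => _ [].
Qed.

(** * Deformation maps *)

Section Deformation.
Variable r : {linear H -> A}.
Hypothesis defr : deformation_map BA BH lact ract r.

Let r_coalg : coalgebra_morphism BH BA r. Proof. by case: defr. Qed.

Definition graph (h : H) : E :=
  \sw_(h1, h2 <- comul BH h) bmul BE (iA (r h1)) (iH h2).

Lemma mult_map_graph_map h : m (graph_map BH r h) = graph h.
Proof.
by rewrite linear_tsum //; apply: eq_tsum => h1 h2; rewrite mult_map_pure.
Qed.

Lemma graph_linear : linear graph.
Proof. by rewrite /graph; linearity. Qed.
Let graphl := graph_linear.

Lemma facH_graph : cancel graph facH.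
Proof.
move=> h; rewrite linear_tsum // -[RHS](tsum_counitl coalgH (f := id)) //.
by apply: eq_tsum => h1 h2; rewrite facH_mult; case: r_coalg => _ _ ->.
Qed.

Lemma graph_one : graph (bone BH) = bone BE.
Proof.
rewrite /graph tsum_comul_one //; last by linearity.
have [_ -> _ _] := defr; have [_ _ ->] := iA_morph; have [_ _ ->] := iH_morph.
by case: bialgE => _ [].
Qed.

Lemma tsum_cocentral (W : lmodType k) (F : A -> H -> W) h : is_bilinear F ->
    \sw_(h1, h2 <- comul BH h) F (r h1) h2
  = \sw_(h1, h2 <- comul BH h) F (r h2) h1.
Proof.
move=> Fb; have [_ _ r_cocentral _] := defr.
have := congr1 (tsum F) (r_cocentral h).
rewrite !tsum_tsum // => E'.
by etransitivity; [|etransitivity; [exact: E'|]]; apply: eq_tsum => a b;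
  rewrite tsum_pure.
Qed.

(** [Δ(graph h) = r(h1) h3 ⊗ r(h2) h4], whereas
    [graph(h1) ⊗ graph(h2) = r(h1) h2 ⊗ r(h3) h4]; the two differ by an
    exchange of the middle factors, which is cocentrality. *)
Lemma graph_coalgebra_morphism : coalgebra_morphism BH BE graph.
Proof.
split=> // h.
  transitivity (\sw_(u, v <- comul BH h) \sw_(h1, h2 <- comul BH u)
     \sw_(h3, h4 <- comul BH v)
       ((bmul BE (iA (r h1)) (iH h3)) ⊗ (bmul BE (iA (r h2)) (iH h4)))).
    rewrite (linear_tsum _ _ (linearP (comul BE))); apply: eq_tsum => u v.
    rewrite -[LHS]tsum_pure_id tsum_comul_mult; last by linearity.
    by rewrite (tsum_coalgebra_morphism _ r_coalg) //; linearity.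
  rewrite tsum_coassoc4 //; try by intros; linearity.
  transitivity (\sw_(u, v <- comul BH h) \sw_(h1, h2 <- comul BH u)
     \sw_(h3, h4 <- comul BH v)
       ((bmul BE (iA (r h1)) (iH h2)) ⊗ (bmul BE (iA (r h3)) (iH h4)))).
    rewrite [RHS]tsum_coassoc4 //; try by intros; linearity.
    apply: eq_tsum => h1 y; apply: eq_tsum => z h4.
    apply: (tsum_cocentral (F := fun a h =>
      (bmul BE (iA (r h1)) (iH h)) ⊗ (bmul BE (iA a) (iH h4)))).
    by linearity.
  apply: eq_tsum => u v.
  rewrite [RHS](linear_tsum (L := fun x => x ⊗ graph v)); last by linearity.
  apply: eq_tsum => h1 h2.
  by rewrite [RHS](linear_tsum (L := fun x => _ ⊗ x)) //; linearity.
rewrite scalar_tsum; last exact: linearP.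
rewrite -[in RHS](tsum_counitl coalgH h (f := id)) // [RHS]scalar_tsum;
  last exact: linearP.
apply: eq_tsum => h1 h2; case: bialgE => _ _ _ [-> _].
rewrite (scalar_scale _ _ (linearP _)).
case: iA_morph => [[_ _ ->] _ _]; case: iH_morph => [[_ _ ->] _ _].
by case: r_coalg => _ _ ->.
Qed.
Let graphC := graph_coalgebra_morphism.

Local Notation dmul := (deformed_mul BH ract r).

(** For [x = h] this is the definition of [•], as [facH] is right [H]-linear;
    left multiplication by [A] acts on both sides through the counit. *)
Lemma facH_mul_graph x g : facH (bmul BE x (graph g)) = dmul (facH x) g.
Proof.
have dmulE h g' : dmul h g' = facH (bmul BE (iH h) (graph g')).
  rewrite /graph (linear_tsum (L := bmul BE _)); last by linearity.
  rewrite linear_tsum //; apply: eq_tsum => g1 g2.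
  by rewrite mulEA facH_mulH.
rewrite dmulE; move: x; apply: eq_linear_mult; try by linearity.
move=> a h; rewrite -mulEA facH_mulA facH_mult iHZ bilinear_scalel //.
by rewrite (linear_scale _ _ facHl).
Qed.

Lemma dmulE h g : dmul h g = facH (bmul BE (graph h) (graph g)).
Proof. by rewrite facH_mul_graph facH_graph. Qed.

(** The left side is [r(h1) facA(h2 r(g)) = r(h1) (h2 ▷ r(g))], the right
    side of the deformation equation. *)
Lemma facA_graph_mul h g : facA (bmul BE (graph h) (graph g)) = r (dmul h g).
Proof.
have [_ _ _ ->] := defr; rewrite [in LHS]/graph.
rewrite (linear_tsum (L := fun x => facA (bmul BE x _))); last by linearity.
apply: eq_tsum => h1 h2; rewrite -mulEA facA_mulA /graph; congr bmul.
rewrite (linear_tsum (L := fun x => facA (bmul BE _ x))); last by linearity.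
rewrite lactE -[in RHS](tsum_counitr coalgH g (f := id)) //.
rewrite [RHS](linear_tsum (L := fun x => facA (bmul BE _ (iA (r x)))));
  last by linearity.
apply: eq_tsum => g1 g2; rewrite mulEA facA_mulH.
rewrite (linear_scale (f := fun x => facA (bmul BE _ (iA (r x))))) //.
by linearity.
Qed.

Lemma tsum_comul_graph_mul (W : lmodType k) (F : E -> E -> W) h g :
    is_bilinear F ->
  tsum F (comul BE (bmul BE (graph h) (graph g)))
  = \sw_(h1, h2 <- comul BH h) \sw_(g1, g2 <- comul BH g)
      F (bmul BE (graph h1) (graph g1)) (bmul BE (graph h2) (graph g2)).
Proof.
move=> Fb; rewrite tsum_comul_mul // (tsum_coalgebra_morphism _ graphC);
  last by linearity.
apply: eq_tsum => h1 h2.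
by rewrite (tsum_coalgebra_morphism _ graphC) //; linearity.
Qed.

(** [•] is the composite of [graph ⊗ graph], the product of [E] and [facH],
    hence compatible with comultiplications. *)
Lemma tsum_comul_dmul (W : lmodType k) (F : H -> H -> W) h g :
    is_bilinear F ->
  tsum F (comul BH (dmul h g))
  = \sw_(h1, h2 <- comul BH h) \sw_(g1, g2 <- comul BH g)
      F (dmul h1 g1) (dmul h2 g2).
Proof.
move=> Fb; rewrite dmulE (tsum_coalgebra_morphism _ facH_coalgebra_morphism) //.
rewrite tsum_comul_graph_mul; last by linearity.
by apply: eq_tsum => h1 h2; apply: eq_tsum => g1 g2; rewrite -!dmulE.
Qed.

(** By [factor_mult] an element of [E] is known from its projections, and
    those of [graph(h) graph(g)] are [r(h • g)] and [h • g]. *)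
Lemma graph_mul : {morph graph : h g / dmul h g >-> bmul BE h g}.
Proof.
move=> h g; rewrite -[RHS]factor_mult tsum_comul_graph_mul; last by linearity.
rewrite /graph tsum_comul_dmul; last by linearity.
apply: eq_tsum => h1 h2; apply: eq_tsum => g1 g2.
by rewrite -!/(graph _) facA_graph_mul -dmulE.
Qed.

Local Notation Hr := (deformed BH ract r).

Lemma graph_hopf_morphism : hopf_morphism Hr BE graph.
Proof. by split=> //; [exact: graph_mul | exact: graph_one]. Qed.

Lemma deformed_bialgebra : is_bialgebra Hr.
Proof.
have graph_inj := can_inj facH_graph.
have [_ [_ _ mulE1 mulE1r] _ [mulE_counit oneE_counit]] := bialgE.
have mulE := graph_mul; have oneE := graph_one.
split=> //.
- split=> [|x y z|x|x] /=; try by apply: graph_inj; rewrite !mulE ?oneE.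
  split=> [h c x y|g c x y] /=; rewrite !dmulE.
    apply: (linear_comp (g := facH)
      (f := fun x => bmul BE (graph x) (graph h))); by linearity.
  apply: (linear_comp (g := facH)
    (f := fun x => bmul BE (graph g) (graph x))); by linearity.
- split=> [x y|] /=; last by case: bialgH => _ _ [_ ->].
  rewrite -[LHS]tsum_pure_id tsum_comul_dmul //; exact: pure_bilinear.
- split=> [x y|] /=; last by case: bialgH => _ _ _ [].
  by have [_ _ gc] := graphC; rewrite -!gc mulE mulE_counit.
Qed.

Section Antipode.
Variables (SA : A -> A) (SH : H -> H) (SE : E -> E).
Hypotheses (antA : is_antipode BA SA) (antH : is_antipode BH SH).
Hypothesis (antE : is_antipode BE SE).

Local Notation S := (deformed_antipode BH ract SA SH r).

(** The convolution inverse of [graph]; [facH] maps it to the proposed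
    antipode. *)
Let graph_inv h :=
  \sw_(h1, h2 <- comul BH h) bmul BE (iH (SH h2)) (iA (SA (r h1))).

Let graph_inv_l : linear graph_inv.
Proof.
by case: antA => ? _ _; case: antH => ? _ _; rewrite /graph_inv; linearity.
Qed.

(** After cocentrality has put [graph_inv] in the order [S_H(h1) S_A(r(h2))],
    the product [r(h1) h2 S_H(h3) S_A(r(h4))] cancels from the inside out.
    Uniqueness of convolution inverses then identifies [S_E(graph h)] without
    expanding the antipode of a product. *)
Lemma graph_convolution_inverse c :
  convolution BH BE graph graph_inv c = counit BH c *: bone BE.
Proof.
have [SAl _ _] := antA; have [SHl _ SHr] := antH.
have [_ _ mulE1 mulE1r] : is_algebra BE by case: bialgE.
have graph_invE h :
      graph_inv h
    = \sw_(h1, h2 <- comul BH h) bmul BE (iH (SH h1)) (iA (SA (r h2))).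
  apply: (tsum_cocentral (F := fun a h => bmul BE (iH (SH h)) (iA (SA a)))).
  by linearity.
transitivity (\sw_(x, y <- comul BH c) \sw_(h1, h2 <- comul BH x)
    \sw_(h3, h4 <- comul BH y) bmul BE (iA (r h1))
      (bmul BE (bmul BE (iH h2) (iH (SH h3))) (iA (SA (r h4))))).
  apply: eq_tsum => x y; rewrite graph_invE.
  rewrite (linear_tsum (L := (bmul BE)^~ _)); last by linearity.
  apply: eq_tsum => h1 h2.
  rewrite (linear_tsum (L := bmul BE _)); last by linearity.
  by apply: eq_tsum => h3 h4; rewrite !mulEA.
rewrite tsum_coassoc4 //; try by intros; linearity.
have algA : is_algebra BA by case: bialgA.
have [_ rSr] := antipode_coalgebra_morphism algA antA r_coalg.
have iA1 : iA (bone BA) = bone BE by case: iA_morph.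
have iH1 : iH (bone BH) = bone BE by case: iH_morph.
rewrite -iA1 -linear_scale // -rSr.
rewrite linear_tsum //; apply: eq_tsum => h1 y; rewrite iAM.
rewrite -(tsum_counitl coalgH y
  (f := fun h => bmul BE (iA (r h1)) (iA (SA (r h))))); last by linearity.
apply: eq_tsum => z h4; rewrite -bilinear_scaler // -[iA (SA _) in RHS]mulE1.
rewrite -bilinear_scalel // -iH1 -linear_scale // -SHr.
rewrite linear_tsum // (linear_tsum (L := (bmul BE)^~ _)); last by linearity.
rewrite [RHS](linear_tsum (L := bmul BE _)); last by linearity.
by apply: eq_tsum => h2 h3; rewrite iHM.
Qed.

Lemma antipode_graph h : SE (graph h) = graph_inv h.
Proof.
have [SEl _ _] := antE; have algE : is_algebra BE by case: bialgE.
have [SEgraph _] := antipode_coalgebra_morphism algE antE graphC.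
move: h; apply: (convolution_inverse_unique (v := graph) coalgH algE) => //.
  by linearity.
exact: graph_convolution_inverse.
Qed.

Lemma deformed_antipodeE h : S h = facH (SE (graph h)).
Proof. by rewrite antipode_graph [RHS]linear_tsum. Qed.

Lemma deformed_is_antipode : is_antipode Hr S.
Proof.
have [SEl _ _] := antE; have algE : is_algebra BE by case: bialgE.
have [SEgraph graphSE] := antipode_coalgebra_morphism algE antE graphC.
have Sl : linear S.
  by move=> c x y; rewrite !deformed_antipodeE graphl SEl facHl.
have Sleft c : \sw_(x, y <- comul BH c) dmul (S x) y = counit BH c *: bone BH.
  rewrite -(facH_graph (bone BH)) -linear_scale // graph_one -SEgraph.
  rewrite [RHS]linear_tsum //.
  by apply: eq_tsum => x y; rewrite facH_mul_graph -deformed_antipodeE.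
(* The left inverse property alone already identifies graph ∘ S, as the
   convolution inverse of graph is unique. *)
have graphS : (fun x => graph (S x)) =1 (fun x => SE (graph x)).
  apply: (convolution_inverse_unique (v := graph) coalgH algE) => //;
    try by linearity.
  move=> c; rewrite -graph_one -linear_scale // -Sleft linear_tsum //.
  by apply: eq_tsum => x y; rewrite graph_mul.
split=> // c; apply: (can_inj facH_graph).
rewrite linear_tsum // linear_scale // graph_one -graphSE.
by apply: eq_tsum => x y; rewrite graph_mul graphS.
Qed.

Lemma deformed_hopf : is_hopf_with Hr S.
Proof. by split; [exact: deformed_bialgebra | exact: deformed_is_antipode]. Qed.

End Antipode.

End Deformation.
End Factorization.

(** * Complements *)

(** Shears compose by convolution: the shear by [u] followed by the shear by
    [v] is the shear by [u * v]; and [r], [SA ∘ r] are mutually inverse. *)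
Lemma shear_bijective (k : comPzRingType) (A H : lmodType k)
    (CH : coalgebra H) (BA : bialgebra A) (SA : A -> A) (r : H -> A) :
    is_coalgebra CH -> is_algebra BA -> is_antipode BA SA ->
    coalgebra_morphism CH BA r ->
  bijective (fun t : A ⊗ H => \sw_(a, h <- t) \sw_(h1, h2 <- comul CH h)
                                (bmul BA a (r h1) ⊗ h2)).
Proof.
move=> coalgH algA antA r_coalg; have [SAl _ _] := antA.
have [mulAb mulAA _ mulA1r] := algA.
have [Sr rS] := antipode_coalgebra_morphism algA antA r_coalg.
pose sh (u : H -> A) (t : A ⊗ H) := \sw_(a, h <- t)
  \sw_(h1, h2 <- comul CH h) (bmul BA a (u h1) ⊗ h2).
have shl u : linear u -> linear (sh u) by move=> ul; rewrite /sh; linearity.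
have shK u v : linear u -> linear v ->
    (forall h, convolution CH BA u v h = counit CH h *: bone BA) ->
    cancel (sh u) (sh v).
  move=> ul vl uv; apply: eq_linear_tensor; [ | exact: linear_idfun | ].
    by apply: linear_comp; apply: shl.
  move=> a h; rewrite [sh u _]tsum_pure; last by linearity.
  rewrite linear_tsum; last exact: shl.
  transitivity (\sw_(h1, y <- comul CH h) \sw_(h2, h3 <- comul CH y)
    (bmul BA a (bmul BA (u h1) (v h2)) ⊗ h3)).
    apply: eq_tsum => h1 y; rewrite [LHS]tsum_pure; last by linearity.
    by apply: eq_tsum => h2 h3; rewrite mulAA.
  rewrite tsum_coassoc //; last by linearity.
  rewrite -[in RHS](tsum_counitl coalgH h (f := fun h => a ⊗ h));
    last by linearity.
  apply: eq_tsum => x y.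
  rewrite -[RHS](bilinear_scalel _ _ _ (pure_bilinear _ _)).
  rewrite -[in RHS](mulA1r a) -(bilinear_scaler _ _ _ mulAb) -uv.
  rewrite [RHS](linear_tsum (L := fun b => bmul BA a b ⊗ y)) //.
  by linearity.
have [rl _ _] := r_coalg.
have SArl : linear (fun h => SA (r h)) by linearity.
by exists (sh (fun h => SA (r h))); apply: shK.
Qed.

Section Complements.
Variable k : comPzRingType.
Implicit Types E A H : lmodType k.

Definition bundle_linear (U V : lmodType k) (f : U -> V) (fl : linear f) :
  {linear U -> V} := HB.pack f (GRing.isLinear.Build _ _ _ _ f fl).

(** Composing the inclusions with an isomorphism [g] of the ambient algebras
    composes the multiplication map with [g] and the splittings with [g']. *)
Lemma complement_isol E E' A H (BE : bialgebra E) (BE' : bialgebra E')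
    (BA : bialgebra A) (BH : bialgebra H) iA iH (g : E -> E') (g' : E' -> E) :
    hopf_morphism BE BE' g -> cancel g g' -> cancel g' g -> is_hopf BE' ->
    is_complement BE BA iA BH iH ->
  is_complement BE' BA (fun a => g (iA a)) BH (fun h => g (iH h)).
Proof.
move=> gM gK g'K hopfE' [subA subH bij_m].
have [[gl _ _] gmul _] := gM; have g'l := linear_inverse gl gK g'K.
have sub (V : lmodType k) (B : bialgebra V) i :
    hopf_subalgebra BE B i -> hopf_subalgebra BE' B (fun x => g (i x)).
  move=> [_ hopfB iM [p iK]]; split=> //; first exact: hopf_morphism_comp iM.
  have pg'l : linear (fun x => p (g' x)) by linearity.
  by exists (bundle_linear pg'l) => x /=; rewrite gK iK.
split; [exact: sub | exact: sub |].
apply: (eq_bij (f := g \o mult_map BE iA iH)).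
  by apply: bij_comp bij_m; exists g'.
by move=> t /=; rewrite linear_tsum //; apply: eq_tsum => a h; rewrite gmul.
Qed.

(** Reparametrizing the complement composes the multiplication map with the
    bijection [id ⊗ f']. *)
Lemma complement_isor E A H H' (BE : bialgebra E) (BA : bialgebra A)
    (BH : bialgebra H) (BH' : bialgebra H') iA iH (f : H -> H') (f' : H' -> H) :
    hopf_morphism BH BH' f -> cancel f f' -> cancel f' f ->
    is_complement BE BA iA BH iH ->
  is_complement BE BA iA BH' (fun x => iH (f' x)).
Proof.
move=> fM fK f'K [subA [hopfE [S hopfH] iHM [p iHK]] bij_m].
have [[fl _ _] _ _] := fM; have f'l := linear_inverse fl fK f'K.
have [_ [[_ [mulEb _ _ _] _ _] _]] := hopfE.
have [_ _ [[iAl _ _] _ _] _] := subA; have [[iHl _ _] _ _] := iHM.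
split=> //.
  split=> //.
  - by eexists; apply: (hopf_transport fK f'K hopfH fM).
  - exact: hopf_morphism_comp iHM (hopf_morphism_inverse fK f'K fM).
  - have fpl : linear (fun x => f (p x)) by linearity.
    by exists (bundle_linear fpl) => x /=; rewrite iHK f'K.
pose n (t : A ⊗ H') := \sw_(a, x <- t) (a ⊗ f' x).
pose n' (t : A ⊗ H) := \sw_(a, h <- t) (a ⊗ f h).
have nl : linear n by rewrite /n; linearity.
have n'l : linear n' by rewrite /n'; linearity.
apply: (eq_bij (f := mult_map BE iA iH \o n)); last first.
  move=> t /=; rewrite [mult_map]lock {1}/n -lock linear_tsum; last by
    apply: tsum_linear; linearity.
  by apply: eq_tsum => a x; rewrite /mult_map tsum_pure //; linearity.
apply: bij_comp bij_m _; exists n'; apply: eq_linear_tensor;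
  try by linearity.
  by move=> a x; rewrite /n' /n !tsum_pure ?f'K //; linearity.
by move=> a h; rewrite /n' /n !tsum_pure ?fK //; linearity.
Qed.

End Complements.

(** * Transport to the image *)

Section Transport.
Variables (k : comPzRingType) (V W : lmodType k).
Variables (f : {linear V -> W}) (g : {linear W -> V}) (B : bialgebra V).

Definition transport_comul (y : W) : W ⊗ W :=
  \sw_(x1, x2 <- comul B (g y)) (f x1 ⊗ f x2).

Fact transport_comul_is_linear : linear transport_comul.
Proof. by rewrite /transport_comul; linearity. Qed.
HB.instance Definition _ := GRing.isLinear.Build k W (W ⊗ W)%type _
  transport_comul transport_comul_is_linear.

Definition transport : bialgebra W :=
  Bialgebra (Coalgebra transport_comul (counit B \o g))
    (fun x y => f (bmul B (g x) (g y))) (f (bone B)).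

Lemma transport_hopf_morphism : cancel f g -> hopf_morphism B transport f.
Proof.
move=> fK; split=> //; last by move=> x y; rewrite /= !fK.
split=> [|x|x] /=; first exact: linearP.
  by rewrite /transport_comul fK.
by rewrite fK.
Qed.

End Transport.

Section ImageIsomorphism.
Variables (k : comPzRingType) (U V : lmodType k) (f : {linear U -> V}).

Fact mem_image u : f u \in image_pred f.
Proof. by apply/asboolP; exists u. Qed.

Definition corestrict (u : U) : image_of f := ImageOf (mem_image u).

Fact corestrict_is_linear : linear corestrict.
Proof. by move=> c x y; apply: val_inj; rewrite linearP /= linearP. Qed.
HB.instance Definition _ := GRing.isLinear.Build k U (image_of f) _
  corestrict corestrict_is_linear.

Lemma image_val_linear : linear (@image_val k U V f).
Proof. exact: (linearP (val : image_of f -> V)). Qed.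

(** A retraction [p] of [f] makes [f] injective, and then its restriction to
    the image inverts the corestriction of [f]. *)
Lemma corestrictK (p : V -> U) : cancel f p ->
  cancel (fun x : image_of f => p (image_val x)) corestrict.
Proof.
move=> fK x; apply: val_inj => /=; have /asboolP[u <-] := image_valP x.
by rewrite fK.
Qed.

End ImageIsomorphism.

(** * The deformed complement *)

(** The multiplication map of [A] and [graph] is [m] composed with the shear
    by [r]. *)
Lemma graph_complement (k : comPzRingType) (E A H : lmodType k)
    (BE : bialgebra E) (BA : bialgebra A) (BH : bialgebra H)
    (SA : A -> A) (SH : H -> H) (iA : A -> E) (iH : H -> E)
    (r : {linear H -> A}) :
  is_antipode BA SA -> is_antipode BH SH -> is_complement BE BA iA BH iH ->
  deformation_map BA BH (canonical_lact BE BH iA iH)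
    (canonical_ract BE BA iA iH) r ->
  is_complement BE BA iA (deformed BH (canonical_ract BE BA iA iH) r)
    (graph BE BH iA iH r).
Proof.
move=> antA antH complH defr.
have [subA [_ _ iHM _] bij_m] := complH.
have [hopfE hopfA iAM _] := subA; have [SE [bialgE antE]] := hopfE.
have facHl := facH_linear complH; have ml := mult_map_linear complH.
split=> //.
  split=> //.
  - exists (deformed_antipode BH (canonical_ract BE BA iA iH) SA SH r).
    exact: (deformed_hopf complH defr antA antH antE).
  - exact: (graph_hopf_morphism complH defr).
  - by exists (bundle_linear facHl); exact: (facH_graph complH defr).
have [S [[coalgH _ _ _] _]] : is_hopf BH by case: complH => [_ []].
have [_ [[_ algA _ _] _]] := hopfA; have [r_coalg _ _ _] := defr.
apply: (eq_bij (bij_comp bij_m (shear_bijective coalgH algA antA r_coalg))).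
move=> t /=; have [_ [mulEb mulEA _ _] _ _] := bialgE.
have [[iAl _ _] iA_mul _] := iAM; have [[iHl _ _] iH_mul _] := iHM.
rewrite linear_tsum //; apply: eq_tsum => a h.
rewrite linear_tsum // [RHS](linear_tsum (L := bmul BE _)); last by linearity.
apply: eq_tsum => h1 h2.
by rewrite (mult_map_pure complH) iA_mul mulEA.
Qed.

Theorem theorem2p6 (k : comPzRingType) (E A H : lmodType k)
    (BE : bialgebra E) (BA : bialgebra A) (BH : bialgebra H)
    (SA : A -> A) (SH : H -> H) (iA : A -> E) (iH : H -> E)
    (r : {linear H -> A})
    (hopfE : is_hopf BE)
    (hopfA : is_hopf_with BA SA)
    (hopfH : is_hopf_with BH SH)
    (subA : hopf_subalgebra BE BA iA)
    (complH : is_complement BE BA iA BH iH)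
    (defr : deformation_map BA BH
              (canonical_lact BE BH iA iH) (canonical_ract BE BA iA iH) r) :
  let lact := canonical_lact BE BH iA iH in
  let ract := canonical_ract BE BA iA iH in
  (* the map f_r, its image as a submodule, and the bicrossed product *)
  let fr : {linear H -> (A ⊗ H)%type} := graph_map BH r in
  let HH := image_of fr in
  let AH := bicrossed BA BH lact ract in
  let Hr := deformed BH ract r in
  coalgebra_morphism BH AH fr
  /\ is_hopf_with Hr (deformed_antipode BH ract SA SH r)
  /\ (exists BHH : bialgebra HH,
        [/\ is_complement AH BA (fun a : A => (a ⊗ bone BH)%R) BHH
              (@image_val k H (A ⊗ H)%type fr),
            is_complement BE BA iA BHH
              (fun x : HH => mult_map BE iA iH (image_val x))
          & hopf_isomorphic Hr BHH]).
Proof.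
move=> lact ract fr HH AH Hr.
have [[bialgA antA] [bialgH antH]] := (hopfA, hopfH).
have [SE hopfSE] := hopfE; have [bialgE antE] := hopfSE.
pose gr := graph BE BH iA iH r.
have compl_graph : is_complement BE BA iA Hr gr.
  exact: (graph_complement antA antH complH defr).
pose m := mult_map BE iA iH; pose m' := mult_inv BE iA iH.
have mK : cancel m m' := mult_mapK complH.
have m'K : cancel m' m := mult_invK complH.
have mM : hopf_morphism AH BE m := mult_map_hopf_morphism complH.
have m'M : hopf_morphism BE AH m' := hopf_morphism_inverse mK m'K mM.
have hopfAH : is_hopf AH.
  by eexists; apply: (hopf_transport m'K mK hopfSE m'M).
have mfr h : m (fr h) = gr h := mult_map_graph_map complH r h.
have grK : cancel gr (facH BE BA iA iH) := facH_graph complH defr.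
have grM : hopf_morphism Hr BE gr := graph_hopf_morphism complH defr.
have hopfHr : is_hopf_with Hr (deformed_antipode BH ract SA SH r).
  exact: (deformed_hopf complH defr antA antH antE).
split.
  have -> : (fr : H -> _) = (fun h => m' (gr h)).
    by apply/funext => h; rewrite -mfr mK.
  have [[m'C _ _] [grC _ _]] := (m'M, grM).
  exact: (coalgebra_morphism_comp m'C grC).
split=> //.
pose p (t : A ⊗ H) : H := facH BE BA iA iH (m t).
have frK : cancel fr p by move=> h; rewrite /p mfr grK.
have pl : linear (fun x : HH => p (image_val x)).
  have facHl := facH_linear complH.
  have ml : linear m := mult_map_linear complH.
  have vl := @image_val_linear _ _ _ fr.
  by rewrite /p; linearity.
pose f : {linear H -> HH} := corestrict fr.
pose BHH := transport f (bundle_linear pl) Hr.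
have fK : cancel f (bundle_linear pl) by move=> h; rewrite /= frK.
have fK' : cancel (bundle_linear pl) f := corestrictK frK.
have fM : hopf_morphism Hr BHH f := transport_hopf_morphism Hr fK.
have grE (x : HH) : m (image_val x) = gr (bundle_linear pl x).
  by rewrite -mfr -{1}(fK' x).
have compl_HH : is_complement BE BA iA BHH (fun x : HH => m (image_val x)).
  rewrite (_ : (fun x => _) = (fun x => gr (bundle_linear pl x))).
    exact: (complement_isor fM fK fK' compl_graph).
  exact/funext.
exists BHH; split=> //; last by exists f => //; exists (bundle_linear pl).
rewrite (_ : (fun a => _) = (fun a => m' (iA a))); last first.
  apply/funext => a; apply: (can_inj mK); rewrite m'K /m (mult_map_pure complH).
  have [_ [_ _ iHM _] _] := complH; have [_ _ ->] := iHM.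
  by have [_ [_ _ _ ->]] := bialgE.
rewrite (_ : @image_val _ _ _ fr = (fun x => m' (m (image_val x)))).
  exact: (complement_isol m'M m'K mK hopfAH compl_HH).
by apply/funext => x; rewrite mK.
Qed.
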